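(* Let $A=\sigma(R)\langle x_1,\dots,x_n\rangle$ be a skew PBW extension over a Baer ring $R$, with associated system $(\Sigma,\Delta)$ of endomorphisms and $\Sigma$-derivations of $R$. Suppose that $\sigma_i\delta_j=\delta_j\sigma_i$, $\delta_i\delta_j=\delta_j\delta_i$, and $\delta_k(d_{i,j})=\delta_k(r_l^{(i,j)})=0$ for $1\le i,j,k,l\le n$. Then $R$ is $\Sigma$-semicommutative if and only if $A$ is $\overline{\Sigma}$-semicommutative, where $\overline{\Sigma}=\{\overline{\sigma_1},\dots,\overline{\sigma_n}\}$ is the family of maps $\overline{\sigma_k}:A\to A$ extending the $\sigma_k$ coefficientwise.
   Context: Rings are associative with identity; $\mathbb{N}$ includes $0$. A ring is Baer if the right (equivalently, left) annihilator of every nonempty subset is generated, as a right (respectively left) ideal, by an idempotent. Skew PBW extension: $A=\sigma(R)\langle x_1,\dots,x_n\rangle$ is a skew PBW extension over $R$ if (i) $R$ is a subring of $A$ with the same identity; (ii) there are $x_1,\dots,x_n\in A$ such that $A$ is a free left $R$-module with basis $\mathrm{Mon}(A):=\{x^\alpha:=x_1^{\alpha_1}\cdots x_n^{\alpha_n}\mid \alpha=(\alpha_1,\dots,\alpha_n)\in\mathbb{N}^n\}$; (iii) for each $i$ and each $r\in R\setminus\{0\}$ there is $c_{i,r}\in R\setminus\{0\}$ with $x_ir-c_{i,r}x_i\in R$; (iv) for all $1\le i,j\le n$ there is $d_{i,j}\in R\setminus\{0\}$ and there are $r_l^{(i,j)}\in R$ with $x_jx_i-d_{i,j}x_ix_j=\sum_{l=0}^n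 r_l^{(i,j)}x_l$, where $x_0:=1$. For such $A$, for each $i$ there are an injective ring endomorphism $\sigma_i$ of $R$ and a $\sigma_i$-derivation $\delta_i$ of $R$ (an additive map with $\delta_i(rs)=\sigma_i(r)\delta_i(s)+\delta_i(r)s$) such that $x_ir=\sigma_i(r)x_i+\delta_i(r)$ for all $r\in R$. Put $\Sigma:=\{\sigma_1,\dots,\sigma_n\}$, $\Delta:=\{\delta_1,\dots,\delta_n\}$, and for $\alpha\in\mathbb{N}^n$, $\sigma^\alpha:=\sigma_1^{\alpha_1}\circ\cdots\circ\sigma_n^{\alpha_n}$. For $f=a_0+a_1X_1+\cdots+a_mX_m\in A$ with $a_i\in R$, $X_i\in\mathrm{Mon}(A)$, define $\overline{\sigma_k}(f):=\sigma_k(a_0)+\sigma_k(a_1)X_1+\cdots+\sigma_k(a_m)X_m$; and $\overline{\sigma}^{\alpha}:=\overline{\sigma_1}^{\alpha_1}\circ\cdots\circ\overline{\sigma_n}^{\alpha_n}$. $R$ is $\Sigma$-semicommutative if for all $a,b\in R$, $ab=0$ implies $aR\sigma^\alpha(b)=0$ for every $\alpha\in\mathbb{N}^n\setminus\{0\}$. Likewise, $A$ is $\overline{\Sigma}$-semicommutative if for all $f,g\in A$, $fg=0$ implies $fA\,\overline{\sigma}^{\alpha}(g)=0$ for every $\alpha\in\mathbb{N}^n\setminus\{0\}$. *)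

(* Defs.v *)
From HB Require Import structures.
From mathcomp Require Import all_boot all_algebra.
From mathcomp Require Import finmap.

Set Implicit Arguments.
Unset Strict Implicit.
Unset Printing Implicit Defensive.

Import GRing.Theory.
Local Open Scope ring_scope.

Definition Baer (R : pzRingType) : Prop :=
  forall S : R -> Prop, (exists s, S s) ->
    exists2 e : R, e * e = e &
      forall y : R, (forall s, S s -> s * y = 0) <-> (exists z, y = e * z).

Notation multi_index n := {ffun 'I_n -> nat}.

(* s_1^(al_1) \o ... \o s_n^(al_n), in this order; the maps need not commute. *)
Definition iterated (T : Type) (n : nat) (s : 'I_n -> T -> T)
    (al : multi_index n) : T -> T :=
  \big[(fun f g : T -> T => f \o g)/id]_(i < n) iter (al i) (s i).

Definition family_semicommutative (B : pzRingType) (n : nat)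
    (s : 'I_n -> B -> B) : Prop :=
  forall a b : B, a * b = 0 ->
  forall al : multi_index n, al <> [ffun=> 0%N] ->
  forall c : B, a * c * iterated s al b = 0.

Notation coefs R n := {fsfun {ffun 'I_n -> nat} -> R with 0}.

Section Expansion.
Variables (R A : pzRingType) (n : nat) (emb : R -> A) (x : 'I_n -> A).

(* x_1^(al_1) ... x_n^(al_n); big products run in increasing index order. *)
Definition std_mon (al : multi_index n) : A := \prod_(i < n) x i ^+ al i.

(* Taking [g := id] gives the plain linear combination. *)
Definition lincomb (g : R -> R) (c : coefs R n) : A :=
  \sum_(al <- finsupp c) emb (g (c al)) * std_mon al.

End Expansion.

(* The subring inclusion R <= A is the injective morphism [emb], and the left
   R-module structure of A is left multiplication by [emb r]. The scalars
   r_0^(i,j) and r_l^(i,j), 1 <= l <= n, are [rconst i j] and [rlin i j l]. *)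
Record skewPBW (R A : pzRingType) (n : nat) := SkewPBW {
  emb : {rmorphism R -> A};
  emb_inj : injective emb;
  var : 'I_n -> A;
  std_basis : forall f : A,
    exists! c : coefs R n, f = lincomb emb var id c;
  var_scalar : forall (i : 'I_n) (r : R), r != 0 ->
    exists2 c : R, c != 0 &
      exists s : R, var i * emb r - emb c * var i = emb s;
  dcoef : 'I_n -> 'I_n -> R;
  dcoef_neq0 : forall i j, dcoef i j != 0;
  rconst : 'I_n -> 'I_n -> R;
  rlin : 'I_n -> 'I_n -> 'I_n -> R;
  var_var : forall i j : 'I_n,
    var j * var i - emb (dcoef i j) * (var i * var j) =
      emb (rconst i j) + \sum_(l < n) emb (rlin i j l) * var l
}.

Section Structure.
Variables (R A : pzRingType) (n : nat) (E : skewPBW R A n).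

Record assoc_system (sigma : 'I_n -> {rmorphism R -> R})
    (delta : 'I_n -> {additive R -> R}) : Prop := AssocSystem {
  sigma_inj : forall i, injective (sigma i);
  delta_derivation : forall i (r s : R),
    delta i (r * s) = sigma i r * delta i s + delta i r * s;
  var_emb : forall i (r : R),
    var E i * emb E r = emb E (sigma i r) * var E i + emb E (delta i r)
}.

Lemma coords_ex (f : A) :
  exists c : coefs R n, f == lincomb (emb E) (var E) id c.
Proof. by have [c [-> _]] := std_basis E f; exists c. Qed.

Definition coords (f : A) : coefs R n :=
  xchoose (coords_ex f).

Definition coef_extension (g : R -> R) (f : A) : A :=
  lincomb (emb E) (var E) g (coords f).

End Structure.

(* Main.v *)
Require Import Defs.
From HB Require Import structures.
From mathcomp Require Import all_boot all_order all_algebra.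
From mathcomp Require Import finmap mpoly.

Set Implicit Arguments.
Unset Strict Implicit.
Unset Printing Implicit Defensive.

Import Order.TTheory GRing.Theory.
Local Open Scope ring_scope.

(** Restricting to constants shows at once that the condition on [A] implies
    the one on [R]: the map induced on [A] by [sigma k] extends [sigma k].

    For the converse, apply the condition on [R] to the relations
    [e * (1 - e) = 0] and [(1 - e) * e = 0] for an idempotent [e]. They say
    first that every [sigma i] fixes [e] ([sigma_idem]) and then that [e] is
    central ([idem_central]). Since [R] is Baer, annihilators are generated by
    such idempotents, so [a * b = 0] implies [b * a = 0] ([mul0_sym]), and
    [a * sigma i b = 0] implies [a * b = 0] ([sigma_rigid]). Derivations kill
    the idempotents ([delta_idem]), so these are even central in [A]
    ([emb_idem_central]).

    The heart of the proof is an Armendariz property ([coef_mul0]): if [f * g =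
    0] in [A], then every coefficient of [f] annihilates every coefficient of
    [g]. In the filtration of [A] by total degree, a product [x^al * b * x^be]
    is [c * x^(al + be)] up to lower degree, where [c] is [sigma^al b] times a
    product of twisted constants [d_(i, j)]. Since the latter are left
    invertible ([dcoef_mul1]) and annihilation in [R] is symmetric, [a * c = 0]
    still implies [a * b = 0] ([mon_emb_mon]). Hence the leading coefficients
    [a0] of [f] and [b0] of [g] satisfy [a0 * b0 = 0]. Let [e] be the
    idempotent generating the right annihilator of [a0]. Then [e * f] has lost
    the leading term of [f] and [(1 - e) * g] that of [g], while both [(e * f)
    * g] and [f * ((1 - e) * g)] vanish; induction on the sizes of the supports
    gives [e * a * b = 0] and [(1 - e) * a * b = 0] for all coefficients [a] of
    [f] and [b] of [g].

    Finally, given [f * g = 0], let [e] generate the right annihilator of the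
    set of all coefficients of [f]. Then [f * e = 0], and [e] fixes the
    coefficients of [g], hence also those of its images under the [sigma i].
    Since [e] is central, [f * h * g' = f * e * h * g' = 0] for every such image
    [g'] ([semicommutative_extension]). *)

(** * Multi-indices *)

Definition delta_idx n (i : 'I_n) : multi_index n := [ffun j => (j == i : nat)].

Definition deg n (al : multi_index n) : nat := (\sum_i al i)%N.

Lemma degD n (al be : multi_index n) : deg (al + be) = (deg al + deg be)%N.
Proof. by rewrite /deg -big_split; apply: eq_bigr => i _; rewrite !ffunE. Qed.

Lemma deg0 n : deg (0 : multi_index n) = 0%N.
Proof. by rewrite /deg big1 // => i _; rewrite ffunE. Qed.

Lemma deg_delta n (i : 'I_n) : deg (delta_idx i) = 1%N.
Proof.
rewrite /deg (bigD1 i) //= big1 ?ffunE ?eqxx // => j ji.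
by rewrite ffunE (negPf ji).
Qed.

(** Splitting off the first variable that occurs in a monomial: together with
    [mon_cons] this is the induction step of every computation with standard
    monomials. *)
Lemma multi_index_split n (al : multi_index n) : al != 0 ->
  exists i be, [/\ al = delta_idx i + be &
    forall j : 'I_n, (j < i)%N -> be j = 0%N].
Proof.
move=> al0; have [i ali] : exists i, al i != 0%N.
  apply/existsP; apply: contraNT al0; rewrite negb_exists => /forallP al0.
  by apply/eqP/ffunP => j; rewrite ffunE; apply/eqP; rewrite -[_ == _]negbK.
have [k alk mink] :=
  @arg_minnP _ i [pred j | al j != 0%N] (fun j => j : nat) ali.
exists k, [ffun j => (al j - (j == k))%N]; split.
  apply/ffunP => j; rewrite !ffunE; case: eqP => [->|_] /=.
    by rewrite [LHS](_ : _ = 1 + (al k - 1))%N // addnC subnK // lt0n.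
  by rewrite subn0 [RHS]add0n.
move=> j jk; rewrite ffunE; suff /eqP -> : al j == 0%N by [].
by apply: contraLR jk => /mink; rewrite -leqNgt.
Qed.

(** In a noncommutative ordered product a factor on the left can be absorbed
    into position [i] because all earlier factors are trivial. *)
Lemma prod_ord_cons (B : pzRingType) n (F G : 'I_n -> B) (i : 'I_n) y :
  (forall j : 'I_n, (j < i)%N -> F j = 1) ->
  G i = y * F i -> (forall j, j != i -> G j = F j) ->
  y * \prod_j F j = \prod_j G j.
Proof.
elim: n => [|n IH] in F G i *; first by case: i.
case: (unliftP ord0 i) => [k|] -> F1 Gi GF; rewrite !big_ord_recl.
  rewrite F1 // GF ?F1 ?neq_lift // !mul1r.
  apply: (IH _ _ k) => // [j jk|j jk]; first by apply: F1; rewrite !lift0 ltnS.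
  by rewrite GF // (inj_eq lift_inj).
rewrite Gi mulrA; congr (_ * _); apply: eq_bigr => j _.
by rewrite GF // eq_sym neq_lift.
Qed.

(** * Coordinates in the standard basis *)

Section Coordinates.
Variables (R A : pzRingType) (n : nat) (E : skewPBW R A n).
Implicit Types (al be ga : multi_index n) (f g h : A) (r : R).

Local Notation mon := (std_mon (var E)).

Definition coef al f : R := coords E f al.

Lemma coordsK f : f = lincomb (emb E) (var E) id (coords E f).
Proof. by apply/eqP; exact: xchooseP (coords_ex E f). Qed.

Lemma expansion f :
  f = \sum_(al <- finsupp (coords E f)) emb E (coef al f) * mon al.
Proof. exact: coordsK. Qed.

(** This is where uniqueness of the expansion enters. Allowing any finite index
    set [S], possibly larger than the support, lets two elements be compared
    over a common index set. *)
Lemma coef_sum_mon (S : {fset multi_index n}) (h : multi_index n -> R) al :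
  coef al (\sum_(be <- S) emb E (h be) * mon be) = if al \in S then h al else 0.
Proof.
set f := (X in coef _ X).
pose c : coefs R n := [fsfun be in S => h be].
have cE be : c be = if be \in S then h be else 0 by rewrite fsfunE.
suff fc : f = lincomb (emb E) (var E) id c.
  have [c' [_ c'U]] := std_basis E f.
  by rewrite /coef -(c'U _ (coordsK f)) (c'U _ fc).
rewrite /lincomb (@big_fset_incl _ _ _ _ _ S); last 2 first.
- by apply/fsubsetP => be; rewrite mem_finsupp cE; case: ifP; rewrite ?eqxx.
- by move=> be _; rewrite memNfinsupp => /eqP ->; rewrite rmorph0 mul0r.
by apply: eq_fbigr => be beS; rewrite cE beS.
Qed.

Lemma mem_supp f al : (al \in finsupp (coords E f)) = (coef al f != 0).
Proof. exact: mem_finsupp. Qed.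

Lemma expansion_sub (S : {fset multi_index n}) f :
  (finsupp (coords E f) `<=` S)%fset ->
  f = \sum_(al <- S) emb E (coef al f) * mon al.
Proof.
move=> fS; rewrite {1}(expansion f); apply: big_fset_incl => // al _.
by rewrite mem_supp negbK => /eqP ->; rewrite rmorph0 mul0r.
Qed.

Lemma coef_is_zmod_morphism al : zmod_morphism (coef al).
Proof.
move=> f g; set S := (finsupp (coords E f) `|` finsupp (coords E g))%fset.
have fS := expansion_sub (fsubsetUl _ _ : (_ `<=` S)%fset).
have gS := expansion_sub (fsubsetUr _ _ : (_ `<=` S)%fset).
have -> : f - g = \sum_(be <- S) emb E (coef be f - coef be g) * mon be.
  rewrite {1}fS {1}gS -sumrB; apply: eq_bigr => be _.
  by rewrite rmorphB mulrBl.
rewrite coef_sum_mon; case: ifPn => //.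
by rewrite inE negb_or !mem_supp !negbK => /andP[/eqP-> /eqP->]; rewrite subr0.
Qed.

HB.instance Definition _ al :=
  GRing.isZmodMorphism.Build A R (coef al) (coef_is_zmod_morphism al).

Lemma coefZ al r f : coef al (emb E r * f) = r * coef al f.
Proof.
rewrite {1}(expansion f) mulr_sumr.
under eq_bigr do rewrite mulrA -rmorphM.
rewrite (coef_sum_mon _ (fun be => r * coef be f)); case: ifPn => //.
by rewrite mem_supp negbK => /eqP ->; rewrite mulr0.
Qed.

Lemma coef_mon al be : coef al (mon be) = (al == be)%:R.
Proof.
have -> : mon be = \sum_(ga <- [fset be]%fset) emb E 1 * mon ga.
  by rewrite big_seq_fset1 rmorph1 mul1r.
by rewrite (coef_sum_mon _ (fun=> 1)) inE; case: eqP.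
Qed.

Lemma coef_inj f g : (forall al, coef al f = coef al g) -> f = g.
Proof.
move=> fg; apply/eqP; rewrite -subr_eq0 (expansion (f - g)) big1 // => al _.
by rewrite raddfB /= fg subrr rmorph0 mul0r.
Qed.

Lemma mon0 : mon 0 = 1.
Proof. by rewrite /std_mon big1 // => i _; rewrite ffunE. Qed.

Lemma coef_emb al r : coef al (emb E r) = if al == 0 then r else 0.
Proof. by rewrite -[emb E r]mulr1 -mon0 coefZ coef_mon mulr_natr mulrb. Qed.

Lemma mon_cons (i : 'I_n) al : (forall j : 'I_n, (j < i)%N -> al j = 0%N) ->
  var E i * mon al = mon (delta_idx i + al).
Proof.
move=> al0; apply: (prod_ord_cons (i := i)) => [j ji||j /negPf ji].
- by rewrite al0 ?expr0.
- by rewrite !ffunE eqxx -exprS.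
- by rewrite !ffunE ji add0r.
Qed.

Lemma mon_delta i : mon (delta_idx i) = var E i.
Proof. by rewrite -[RHS]mulr1 -mon0 mon_cons ?addr0 // => j; rewrite ffunE. Qed.

Lemma coef_extensionE (g : R -> R) f al : g 0 = 0 ->
  coef al (coef_extension E g f) = g (coef al f).
Proof.
move=> g0; rewrite /coef_extension /lincomb.
rewrite (coef_sum_mon _ (fun be => g (coords E f be))).
by case: ifPn => //; rewrite mem_supp negbK => /eqP ->; rewrite g0.
Qed.

Definition deg_lt k f := forall al, (k <= deg al)%N -> coef al f = 0.

Lemma deg_lt0 k : deg_lt k 0.
Proof. by move=> al _; rewrite raddf0. Qed.

Lemma deg_ltD k f g : deg_lt k f -> deg_lt k g -> deg_lt k (f + g).
Proof. by move=> fk gk al alk; rewrite raddfD /= fk ?gk ?addr0. Qed.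

Lemma deg_ltZ k r f : deg_lt k f -> deg_lt k (emb E r * f).
Proof. by move=> fk al alk; rewrite coefZ fk ?mulr0. Qed.

Lemma deg_ltW k l f : (k <= l)%N -> deg_lt k f -> deg_lt l f.
Proof. by move=> kl fk al lal; apply: fk; apply: leq_trans lal. Qed.

Lemma deg_lt_sum k (I : Type) (s : seq I) (F : I -> A) :
  (forall i, deg_lt k (F i)) -> deg_lt k (\sum_(i <- s) F i).
Proof.
move=> Fk; elim/big_rec: _ => [|i f _ fk]; first exact: deg_lt0.
exact: deg_ltD.
Qed.

Lemma deg_lt_mon al k : (deg al < k)%N -> deg_lt k (mon al).
Proof.
move=> alk be kbe; rewrite coef_mon; case: eqP => // bal.
by rewrite -bal ltnNge kbe in alk.
Qed.

Lemma deg_lt_ind (P : A -> Prop) k :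
  P 0 -> (forall f g, P f -> P g -> P (f + g)) ->
  (forall r al, (deg al < k)%N -> P (emb E r * mon al)) ->
  forall f, deg_lt k f -> P f.
Proof.
move=> P0 PD Pmon f fk; rewrite (expansion f); elim/big_rec: _ => // al g _ Pg.
apply: PD => //; case: (ltnP (deg al) k) => [/Pmon //|/fk ->].
by rewrite rmorph0 mul0r.
Qed.

End Coordinates.

(** * Straightening products of monomials *)

Definition right_regular (R : pzRingType) (d : R) :=
  forall a, a * d = 0 -> a = 0.

Section Straightening.
Variables (R A : pzRingType) (n : nat) (E : skewPBW R A n).
Variables (sigma : 'I_n -> {rmorphism R -> R}).
Variables (delta : 'I_n -> {additive R -> R}).
Hypothesis sysE : assoc_system E sigma delta.
Hypothesis rigid : forall i a b, a * sigma i b = 0 -> a * b = 0.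
Hypothesis dcoef_regular :
  forall i j : 'I_n, (i < j)%N -> right_regular (dcoef E i j).
Implicit Types (al be ga : multi_index n) (f g h : A) (r : R).

Local Notation mon := (std_mon (var E)).

(** The assumption is the case of monomials; it is kept as a premise because
    this lemma is used inside the induction proving it. *)
Lemma var_mul_deg_lt j k f :
  (forall al, (deg al < k)%N -> deg_lt E k.+1 (var E j * mon al)) ->
  deg_lt E k f -> deg_lt E k.+1 (var E j * f).
Proof.
move=> Hmon; pose P g := deg_lt E k.+1 (var E j * g).
apply: (deg_lt_ind (P := P)) => [|g h gk hk|r al alk]; rewrite /P.
- by rewrite mulr0; exact: deg_lt0.
- by rewrite mulrDr; exact: deg_ltD.
rewrite mulrA (var_emb sysE) mulrDl -mulrA; apply: deg_ltD.
  by apply: deg_ltZ; exact: Hmon.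
by apply: deg_ltZ; apply: deg_lt_mon; exact: ltnW.
Qed.

(** The variable [x_j] is moved to its place in [x^al]. If it comes
    after the first variable [x_i] of [x^al], swap the two: this costs the
    factor [d_(i, j)] and terms of lower degree. By induction on the degree
    [x_j] can be moved through the remainder of [x^al] at the cost of some [d];
    moving [x_i] back through [d] turns it into [sigma i d] and produces
    [delta i d] in lower degree. *)
Lemma straighten_var j al : exists2 d, right_regular d &
  deg_lt E (deg al).+1 (var E j * mon al - emb E d * mon (delta_idx j + al)).
Proof.
have [k] := ubnP (deg al); elim: k => // k IH in j al *; rewrite ltnS => alk.
have reg1 : right_regular (1 : R) by move=> a; rewrite mulr1.
case: (eqVneq al 0) => [->|al0].
  exists 1 => //; rewrite mon0 addr0 mon_delta mulr1 rmorph1 mul1r subrr.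
  exact: deg_lt0.
have [i [be [alE bei]]] := multi_index_split al0.
have dal : deg al = (deg be).+1 by rewrite alE degD deg_delta.
case: (leqP j i) => [ji|ij].
  exists 1 => //; rewrite rmorph1 mul1r mon_cons ?subrr; first exact: deg_lt0.
  move=> l lj; rewrite alE !ffunE bei ?(leq_trans lj ji) // addr0.
  by rewrite -val_eqE /= ltn_eqF // (leq_trans lj ji).
have up l ga : (deg ga < k)%N -> deg_lt E (deg ga).+2 (var E l * mon ga).
  move=> gak; have [d _ dP] := IH l ga gak.
  rewrite -[var E l * _](subrK (emb E d * mon (delta_idx l + ga))).
  apply: deg_ltD; first exact: deg_ltW dP.
  by apply: deg_ltZ; apply: deg_lt_mon; rewrite degD deg_delta.
have up_lt l f : deg_lt E (deg al) f -> deg_lt E (deg al).+1 (var E l * f).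
  apply: var_mul_deg_lt => ga gaal.
  by apply: deg_ltW (up _ _ (leq_trans gaal alk)).
have bek : (deg be < k)%N by rewrite -dal.
have [d dreg dP] := IH j be bek.
rewrite -dal in dP.
exists (dcoef E i j * sigma i d).
  move=> a; rewrite mulrA => /rigid /dreg; exact: dcoef_regular.
rewrite alE -(mon_cons E bei) mulrA.
have jbe (l : 'I_n) : (l < i)%N -> (delta_idx j + be) l = 0%N.
  move=> li; rewrite !ffunE bei // addr0.
  by rewrite -val_eqE /= ltn_eqF // (ltn_trans li ij).
(* Everything but the leading term: [low] comes from swapping the variables,
   [rest] from the induction hypothesis. *)
set low := emb E (rconst E i j) + \sum_(l < n) emb E (rlin E i j l) * var E l.
set rest := var E j * mon be - emb E d * mon (delta_idx j + be).
have -> : var E j * var E i * mon be - emb E (dcoef E i j * sigma i d) *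
    mon (delta_idx j + (delta_idx i + be)) =
  emb E (dcoef E i j) *
    (emb E (delta i d) * mon (delta_idx j + be) + var E i * rest) +
  low * mon be.
  have /(canRL (subrK _)) -> := var_var E i j; rewrite -/low.
  have -> : emb E (delta i d) = var E i * emb E d - emb E (sigma i d) * var E i.
    by rewrite (var_emb sysE) addrAC subrr add0r.
  rewrite addrCA -(mon_cons E jbe) mulrBr mulrBl !mulrA.
  rewrite [X in _ = _ * X + _]addrC addrA subrK.
  by rewrite mulrBr mulrDl rmorphM !mulrA addrAC [RHS]addrC addrA addrAC.
rewrite -alE.
apply: deg_ltD.
  apply: deg_ltZ; apply: deg_ltD; last exact: up_lt.
  by apply: deg_ltZ; apply: deg_lt_mon; rewrite degD deg_delta dal.
rewrite mulrDl mulr_suml dal; apply: deg_ltD.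
  by apply: deg_ltZ; apply: deg_lt_mon; rewrite ltnW.
by apply: deg_lt_sum => l; rewrite -mulrA; apply: deg_ltZ; exact: up.
Qed.

Lemma var_deg_lt j k f : deg_lt E k f -> deg_lt E k.+1 (var E j * f).
Proof.
apply: var_mul_deg_lt => al alk; have [d _ dP] := straighten_var j al.
rewrite -[var E j * _](subrK (emb E d * mon (delta_idx j + al))).
apply: deg_ltD; first by apply: deg_ltW dP; exact: ltnW.
by apply: deg_ltZ; apply: deg_lt_mon; rewrite degD deg_delta add1n.
Qed.

(** Only the annihilator of [c] matters later, so [c] is not computed; it is
    [sigma^al b] times a right regular factor, with twists by the [sigma i]. *)
Lemma mon_emb_mon al be b :
  exists2 c, (forall a, a * c = 0 -> a * b = 0) &
    deg_lt E (deg al + deg be)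
      (mon al * emb E b * mon be - emb E c * mon (al + be)).
Proof.
have [k] := ubnP (deg al); elim: k => // k IH in al *; rewrite ltnS => alk.
case: (eqVneq al 0) => [->|al0].
  by exists b => //; rewrite mon0 mul1r add0r subrr; exact: deg_lt0.
have [i [al' [alE al'i]]] := multi_index_split al0.
have dal : deg al = (deg al').+1 by rewrite alE degD deg_delta.
have [|c cb cP] := IH al'; first by rewrite -dal.
have [d dreg dP] := straighten_var i (al' + be).
exists (sigma i c * d).
  by move=> a; rewrite mulrA => /dreg /rigid /cb.
set M := mon (al' + be) in cP dP *.
rewrite dal addSn alE -addrA -(mon_cons E al'i).
have -> : var E i * mon al' * emb E b * mon be -
    emb E (sigma i c * d) * mon (delta_idx i + (al' + be)) =
  var E i * (mon al' * emb E b * mon be - emb E c * M) + emb E (delta i c) * M +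
  emb E (sigma i c) * (var E i * M - emb E d * mon (delta_idx i + (al' + be))).
  have -> : emb E (delta i c) = var E i * emb E c - emb E (sigma i c) * var E i.
    by rewrite (var_emb sysE) addrAC subrr add0r.
  by rewrite rmorphM !mulrBr mulrBl !mulrA !addrA !subrK.
apply: deg_ltD; first apply: deg_ltD; first exact: var_deg_lt.
  by apply: deg_ltZ; apply: deg_lt_mon; rewrite degD.
by apply: deg_ltZ; rewrite -degD.
Qed.

(** The degree-lexicographic order on exponents is borrowed from commutative
    monomials. *)
Definition mnm al : 'X_{1.. n} := [multinom al i | i < n].

Lemma mnmD al be : mnm (al + be) = (mnm al + mnm be)%MM.
Proof. by apply/mnmP => i; rewrite mnmDE !mnmE ffunE. Qed.

Lemma mdeg_mnm al : mdeg (mnm al) = deg al.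
Proof. by rewrite mdegE; apply: eq_bigr => i _; rewrite mnmE. Qed.

Lemma mnm_inj : injective mnm.
Proof.
by move=> al be /mnmP ab; apply/ffunP => i; have := ab i; rewrite !mnmE.
Qed.

Definition is_lead f al :=
  coef E al f != 0 /\ forall be, coef E be f != 0 -> (mnm be <= mnm al)%O.

Lemma lead_exists f be : coef E be f != 0 -> exists al, is_lead f al.
Proof.
rewrite -mem_supp => bef.
have [al _ almax] :=
  @arg_maxP _ _ _ [` bef]%fset xpredT (fun u => mnm (val u)) isT.
exists (val al); split=> [|ga]; first by rewrite -mem_supp; exact: valP.
by rewrite -mem_supp => gaf; apply: (almax [` gaf]%fset).
Qed.

Lemma coef_mon_emb_mon al be al' be' b :
  (mnm al' <= mnm al)%O -> (mnm be' <= mnm be)%O -> (al', be') != (al, be) ->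
  coef E (al + be) (mon al' * emb E b * mon be') = 0.
Proof.
move=> leal lebe neq; have [c _ /(_ (al + be))] := mon_emb_mon al' be' b.
rewrite raddfB /= coefZ coef_mon degD leq_add -?mdeg_mnm ?lemc_mdeg //.
move=> /(_ isT) /eqP; rewrite subr_eq0 => /eqP ->.
suff /negPf -> : al + be != al' + be' by rewrite mulr0.
apply: contraNneq neq => /(congr1 mnm); rewrite !mnmD => E1.
have [E2|neq2] := eqVneq (mnm al') (mnm al).
  move: E1; rewrite E2 => /addmI /mnm_inj ->; by rewrite (mnm_inj E2).
have lt_al : (mnm al' < mnm al)%O by rewrite lt_neqAle neq2.
by have := ltmc_le_add lt_al lebe; rewrite E1 ltxx.
Qed.

(** Only the product of the two leading terms reaches the exponent [al + be]:
    other pairs of exponents have a strictly smaller sum, and the corrections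
    from straightening have smaller total degree. *)
Lemma coef_lead_mul f g al be : is_lead f al -> is_lead g be ->
  exists2 c, coef E (al + be) (f * g) = coef E al f * c &
    forall a, a * c = 0 -> a * coef E be g = 0.
Proof.
move=> [alf alM] [beg beM]; have [c cb cP] := mon_emb_mon al be (coef E be g).
exists c => //.
rewrite {1}(expansion E f) {1}(expansion E g) mulr_suml raddf_sum /=.
rewrite (bigD1_seq al) ?fset_uniq ?mem_supp //=.
rewrite [X in _ + X]big1_seq; last first.
  move=> ga /andP[gaal]; rewrite mem_supp => /alM gaf.
  rewrite mulr_sumr raddf_sum big1_seq // => ga' /andP[_].
  rewrite mem_supp => /beM gag.
  rewrite /= -mulrA coefZ mulrA coef_mon_emb_mon ?mulr0 //.
  by apply: contraNneq gaal => -[->].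
rewrite addr0 mulr_sumr raddf_sum (bigD1_seq be) ?fset_uniq ?mem_supp //=.
rewrite [X in _ + X]big1_seq; last first.
  move=> ga' /andP[gabe]; rewrite mem_supp => /beM gag.
  rewrite /= -mulrA coefZ mulrA coef_mon_emb_mon ?mulr0 //.
  by apply: contraNneq gabe => -[->].
rewrite addr0 -mulrA coefZ mulrA; congr (_ * _).
have /eqP := cP (al + be) (eq_leq (esym (degD _ _))).
by rewrite raddfB /= coefZ coef_mon eqxx mulr1 subr_eq0 => /eqP.
Qed.

End Straightening.

(** Swapping [x_i] and [x_j] twice must give back the basis element
    [x_i * x_j]. *)
Lemma dcoef_mul1 (R A : pzRingType) n (E : skewPBW R A n) (i j : 'I_n) :
  (i < j)%N -> dcoef E j i * dcoef E i j = 1.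
Proof.
move=> ij; pose ga := delta_idx i + delta_idx j.
have xij : var E i * var E j = std_mon (var E) ga.
  rewrite -[var E j]mon_delta mon_cons // => l li; rewrite ffunE.
  by rewrite -val_eqE /= ltn_eqF // (ltn_trans li ij).
have rel k l : coef E ga (var E l * var E k) =
    dcoef E k l * coef E ga (var E k * var E l).
  apply/eqP; rewrite -subr_eq0 -coefZ -raddfB /= (var_var E k l); apply/eqP.
  have : (2 <= deg ga)%N by rewrite degD !deg_delta.
  move: ga {xij}; apply: deg_ltD.
    rewrite -[emb E _]mulr1 -(mon0 E); apply: deg_ltZ.
    by apply: deg_lt_mon; rewrite deg0.
  apply: deg_lt_sum => m; apply: deg_ltZ.
  by rewrite -mon_delta; apply: deg_lt_mon; rewrite deg_delta.
by have := rel j i; rewrite (rel i j) xij coef_mon eqxx mulr1 => /esym.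
Qed.

(** * Composites of the endomorphisms *)

Lemma iterated_ind (T : Type) n (s : 'I_n -> T -> T) (P : T -> Prop) :
  (forall i b, P b -> P (s i b)) -> forall al b, P b -> P (iterated s al b).
Proof.
move=> Ps al; rewrite /iterated.
elim/big_rec: _ => [|i f _ IH] b Pb //=.
by elim: (al i) => [|k IHk] /=; [exact: IH | exact: Ps].
Qed.

Lemma iterated_delta (T : Type) n (s : 'I_n -> T -> T) i b :
  iterated s (delta_idx i) b = s i b.
Proof.
have step (r : seq 'I_n) : uniq r ->
    (\big[(fun f g : T -> T => f \o g)/id]_(j <- r)
       iter (delta_idx i j) (s j)) b = if i \in r then s i b else b.
  elim: r => [|j r IH] /=; first by rewrite big_nil.
  case/andP=> jr ur; rewrite big_cons /= IH // inE ffunE [i == j]eq_sym.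
  by case: (eqVneq j i) jr => [-> /negPf ->|].
by rewrite /iterated step ?index_enum_uniq // mem_index_enum.
Qed.

Lemma delta_idx_neq0 n (i : 'I_n) : delta_idx i <> [ffun=> 0%N].
Proof. by move/ffunP/(_ i); rewrite !ffunE eqxx. Qed.

(** * Semicommutative Baer rings *)

Section SemicommutativeBaer.
Variables (R : pzRingType) (n : nat) (i0 : 'I_n).
Variables (sigma : 'I_n -> {rmorphism R -> R}).
Hypothesis sigmaI : forall i, injective (sigma i).
Hypothesis baerR : Baer R.
Hypothesis scR : family_semicommutative (fun i => sigma i : R -> R).
Implicit Types (a b c e : R).

Lemma semicomm_sigma i a b c : a * b = 0 -> a * c * sigma i b = 0.
Proof.
by move=> /scR /(_ _ (@delta_idx_neq0 _ i) c); rewrite iterated_delta.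
Qed.

(** The relation [(1 - e) * e = 0] gives [sigma i e = e * sigma i e], and
    [e * (1 - e) = 0] gives [e = e * sigma i e]. *)
Lemma sigma_idem i e : e * e = e -> sigma i e = e.
Proof.
move=> ee.
have := @semicomm_sigma i (1 - e) e 1; rewrite mulr1 !mulrBl mul1r ee subrr.
move=> /(_ erefl) /eqP; rewrite mul1r subr_eq0 => /eqP ->.
have := @semicomm_sigma i e (1 - e) 1; rewrite mulr1 rmorphB rmorph1.
by rewrite !mulrBr !mulr1 ee subrr => /(_ erefl) /eqP; rewrite subr_eq0 => /eqP.
Qed.

(** As [sigma i0] fixes [e], the condition gives [e * c * (1 - e) = 0] and
    [(1 - e) * c * e = 0]. It says nothing if there is no endomorphism at all,
    whence the index [i0]. *)
Lemma idem_central e c : e * e = e -> e * c = c * e.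
Proof.
move=> ee; have ec : e * c = e * c * e.
  have := @semicomm_sigma i0 e (1 - e) c; rewrite rmorphB rmorph1 sigma_idem //.
  rewrite !mulrBr !mulr1 ee subrr => /(_ erefl) /eqP.
  by rewrite subr_eq0 => /eqP.
have := @semicomm_sigma i0 (1 - e) e c; rewrite sigma_idem // !mulrBl mul1r ee.
by rewrite subrr mul1r => /(_ erefl) /eqP; rewrite subr_eq0 => /eqP ->.
Qed.

Lemma baer_annihilator a : exists e, [/\ e * e = e, a * e = 0 &
  forall b, a * b = 0 -> e * b = b].
Proof.
have [|e ee eP] := baerR (S := eq a); first by exists a.
exists e; split=> // [|b ab].
  by apply: (proj2 (eP e)) => //; exists 1; rewrite mulr1.
have [|z ->] := proj1 (eP b); first by move=> _ <-.
by rewrite mulrA ee.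
Qed.

(** If [e] generates the right annihilator of [a], then [b = e * b] and
    [b * a = e * b * a = b * (a * e) = 0]. *)
Lemma mul0_sym a b : a * b = 0 -> b * a = 0.
Proof.
have [e [ee ae eb]] := baer_annihilator a.
move=> /eb <-; rewrite (idem_central b ee) -mulrA (idem_central a ee).
by rewrite ae mulr0.
Qed.

(** If [e] generates the right annihilator of [a], then [sigma i b] equals
    [e * sigma i b = sigma i (e * b)], so [b = e * b] by injectivity. *)
Lemma sigma_rigid i a b : a * sigma i b = 0 -> a * b = 0.
Proof.
have [e [ee ae eb]] := baer_annihilator a.
move=> /eb; rewrite -{1}(sigma_idem i ee) -rmorphM => /sigmaI <-.
by rewrite mulrA ae mul0r.
Qed.

End SemicommutativeBaer.

(** * The Armendariz property and the extension *)

Section Forward.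
Variables (R A : pzRingType) (n : nat) (E : skewPBW R A n) (i0 : 'I_n).
Variables (sigma : 'I_n -> {rmorphism R -> R}).
Variables (delta : 'I_n -> {additive R -> R}).
Hypothesis sysE : assoc_system E sigma delta.
Hypothesis baerR : Baer R.
Hypothesis scR : family_semicommutative (fun i => sigma i : R -> R).
Implicit Types (al be : multi_index n) (f g h : A) (e : R).

Let rigid := sigma_rigid (sigma_inj sysE) baerR scR.

(** Left invertibility only excludes nonzero [a] with [dcoef E i j * a = 0];
    symmetry of annihilation carries this to the other side. *)
Lemma dcoef_right_regular (i j : 'I_n) :
  (i < j)%N -> right_regular (dcoef E i j).
Proof.
move=> ij a /(mul0_sym i0 baerR scR) da0.
by rewrite -[a]mul1r -(dcoef_mul1 E ij) -mulrA da0 mulr0.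
Qed.

(** Put [d = delta i e]. As [e] is central and fixed by [sigma i], the
    derivation rule for [e * e = e] gives
    [d = e * d + e * d]; multiplying by [e] yields [e * d = 0], hence
    [d = 0]. *)
Lemma delta_idem i e : e * e = e -> delta i e = 0.
Proof.
move=> ee; have := delta_derivation sysE i e e.
rewrite ee (sigma_idem scR) // -(idem_central i0 scR _ ee).
set d := delta i e => dE.
have /eqP : e * d = e * d + e * d by rewrite {1}dE mulrDr !mulrA ee.
rewrite -{1}[e * d]addr0 (inj_eq (addrI _)) eq_sym => /eqP ed.
by rewrite dE ed addr0.
Qed.

Lemma emb_idem_central e f : e * e = e -> emb E e * f = f * emb E e.
Proof.
move=> ee; rewrite [f](expansion E f) mulr_sumr mulr_suml.
apply: eq_bigr => al _.
rewrite mulrA -rmorphM (idem_central i0 scR _ ee) rmorphM -!mulrA.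
congr (_ * _).
apply: commr_prod => i _; apply: commrX; rewrite /GRing.comm.
by rewrite (var_emb sysE) (sigma_idem scR) // delta_idem // rmorph0 addr0.
Qed.

(** Induction on the total size of the supports: the idempotent [e] generating
    the right annihilator of the leading coefficient of [f] removes a term from
    [f], and [1 - e] removes a term from [g]. *)
Lemma coef_mul0 f g : f * g = 0 -> forall al be, coef E al f * coef E be g = 0.
Proof.
have [k] := ubnP (#|` finsupp (coords E f)| + #|` finsupp (coords E g)|).
elim: k => // k IH in f g *; rewrite ltnS => fgk fg0 al be.
have [->|alf] := eqVneq (coef E al f) 0; first by rewrite mul0r.
have [->|beg] := eqVneq (coef E be g) 0; first by rewrite mulr0.
have [al0 leadf] := lead_exists alf; have [be0 leadg] := lead_exists beg.
have [c] := coef_lead_mul sysE rigid dcoef_right_regular leadf leadg.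
rewrite fg0 raddf0 => /esym abc /(_ _ abc) ab0.
have [alf0 _] := leadf; have [beg0 _] := leadg.
have [e [ee ae eb]] := baer_annihilator baerR (coef E al0 f).
have {}eb := eb _ ab0.
pose e' := 1 - e; have ee' : e' * e' = e'.
  by rewrite /e' mulrBl mul1r mulrBr mulr1 ee subrr subr0.
have shrink e1 h ga : coef E ga h != 0 -> e1 * coef E ga h = 0 ->
    (#|` finsupp (coords E (emb E e1 * h))| < #|` finsupp (coords E h)|)%N.
  move=> gah e1h; apply: fproper_ltn_card; rewrite fproperE; apply/andP; split.
    apply/fsubsetP => x; rewrite !mem_supp coefZ.
    by apply: contraNneq => ->; rewrite mulr0.
  by apply/fsubsetPn; exists ga; rewrite mem_supp // coefZ e1h eqxx.
have ea : e * coef E al0 f = 0 by rewrite (idem_central i0 scR).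
have e'b : e' * coef E be0 g = 0 by rewrite mulrBl mul1r eb subrr.
have H1 : e * coef E al f * coef E be g = 0.
  rewrite -(coefZ E al e f); apply: IH; last by rewrite -mulrA fg0 mulr0.
  by apply: leq_trans fgk; rewrite ltn_add2r (shrink _ _ al0).
have H2 : coef E al f * (e' * coef E be g) = 0.
  rewrite -(coefZ E be e' g); apply: IH.
    by apply: leq_trans fgk; rewrite ltn_add2l (shrink _ _ be0).
  by rewrite mulrA -emb_idem_central // -mulrA fg0 mulr0.
move: H2; rewrite mulrA -(idem_central i0 scR _ ee') mulrBl mul1r mulrBl H1.
by rewrite subr0.
Qed.

(** The right annihilator of all coefficients of [f] is generated by an
    idempotent [e]; it kills [f], is central, and fixes every coefficient of
    [g]. *)
Lemma semicommutative_extension :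
  family_semicommutative (fun k => coef_extension E (sigma k)).
Proof.
move=> f g fg0 al _ h; have fg := coef_mul0 fg0.
have [|e ee eP] := baerR (S := fun r => exists be, r = coef E be f).
  by exists (coef E 0 f); exists 0.
have fe : f * emb E e = 0.
  rewrite -emb_idem_central //; apply: (coef_inj (E := E)) => be.
  rewrite coefZ raddf0 (idem_central i0 scR _ ee).
  apply: (proj2 (eP e)); last by exists be.
  by exists 1; rewrite mulr1.
suff -> : iterated (fun k => coef_extension E (sigma k)) al g =
    emb E e * iterated (fun k => coef_extension E (sigma k)) al g.
  by rewrite mulrA -[f * h * _]mulrA -emb_idem_central // mulrA fe !mul0r.
apply: (iterated_ind (P := fun g => g = emb E e * g)) => [i b bE|].
  apply: (coef_inj (E := E)) => be; rewrite coefZ !coef_extensionE ?rmorph0 //.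
  by rewrite {1}bE coefZ rmorphM (sigma_idem scR).
apply: (coef_inj (E := E)) => be; rewrite coefZ.
have [|z ->] := proj1 (eP (coef E be g)); last by rewrite mulrA ee.
by move=> _ [ga ->].
Qed.

End Forward.

Lemma coef_extension_emb (R A : pzRingType) n (E : skewPBW R A n)
  (g : R -> R) r : g 0 = 0 -> coef_extension E g (emb E r) = emb E (g r).
Proof.
move=> g0; apply: (coef_inj (E := E)) => al.
by rewrite coef_extensionE // !coef_emb; case: ifP.
Qed.

Lemma semicommutative_restriction (R A : pzRingType) n (E : skewPBW R A n)
  (sigma : 'I_n -> {rmorphism R -> R}) :
  family_semicommutative (fun k => coef_extension E (sigma k)) ->
  family_semicommutative (fun i => sigma i : R -> R).
Proof.
move=> scA a b ab0 al al0 c; apply: (@emb_inj _ _ _ E).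
have embE : iterated (fun k => coef_extension E (sigma k)) al (emb E b) =
    emb E (iterated (fun i => sigma i : R -> R) al b).
  move: b {ab0}; rewrite /iterated; elim/big_rec2: _ => // i f g _ IH b /=.
  by rewrite IH; elim: (al i) => //= k ->; rewrite coef_extension_emb ?rmorph0.
rewrite !rmorphM rmorph0 -embE; apply: scA => //.
by rewrite -rmorphM ab0 rmorph0.
Qed.

Theorem theorem4p11 (R A : pzRingType) (n : nat) (E : skewPBW R A n)
    (sigma : 'I_n -> {rmorphism R -> R}) (delta : 'I_n -> {additive R -> R})
    (baerR : Baer R) (sysE : assoc_system E sigma delta)
    (sigma_delta : forall (i j : 'I_n) (a : R),
      sigma i (delta j a) = delta j (sigma i a))
    (delta_delta : forall (i j : 'I_n) (a : R),
      delta i (delta j a) = delta j (delta i a))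
    (delta_dcoef : forall i j k : 'I_n, delta k (dcoef E i j) = 0)
    (delta_rlin : forall i j k l : 'I_n, delta k (rlin E i j l) = 0) :
  family_semicommutative (fun i => sigma i : R -> R) <->
  family_semicommutative (fun k => coef_extension E (sigma k)).
Proof.
split=> [scR f g fg0 al al0|]; last exact: semicommutative_restriction.
case: (pickP 'I_n) => [i0 _|no_idx].
  exact: (semicommutative_extension i0 sysE baerR scR fg0 al0).
by case: al0; apply/ffunP => i; have := no_idx i.
Qed.
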